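(* Let $D=2\mathcal D+1$ be an odd positive integer, let $\tilde Q_D$ be the antipodal quotient of the $D$-cube with adjacency matrix $\tilde{\mathbf A}$, base vertex $[\mathbf x]$, Terwilliger algebra $\tilde T=\tilde T([\mathbf x])$, and dual adjacency matrix $\tilde{\mathbf B}$ with respect to $[\mathbf x]$ and the $Q$-polynomial ordering $\{(-1)^i(D-2i)\}_{i=0}^{\mathcal D}$, and let $\tilde{\mathbf C}=\tfrac12(\tilde{\mathbf A}\tilde{\mathbf B}+\tilde{\mathbf B}\tilde{\mathbf A})$. Let $W$ be an irreducible $\tilde T$-module. Then the actions of $\tilde{\mathbf A},\tilde{\mathbf B},\tilde{\mathbf C}$ on $W$ form a totally almost bipartite Leonard triple of Bannai/Ito type.
   Context: The $D$-cube has vertex set $\{0,1\}^D$, two vertices adjacent iff they differ in exactly one coordinate. For a vertex $\mathbf y$, $\mathbf y'$ is the vertex differing from it in every coordinate and $[\mathbf y]=\{\mathbf y,\mathbf y'\}$. $\tilde Q_D$ has vertex set $\tilde{\mathcal X}=\{[\mathbf y]\}$, with $\mathbf u,\mathbf v$ adjacent iff some representatives are adjacent in the $D$-cube; $\tilde\partial$ is its path-length distance; $\tilde V=\mathbb C^{\tilde{\mathcal X}}$ is its standard module. $\tilde{\mathbf A}$ is the adjacency matrix; $\tilde{\mathbf B}$ is the diagonal matrix with $(\mathbf u,\mathbf u)$-entry $|\tilde{\mathcal X}|(\tilde{\mathbf F}_1)_{[\mathbf x]\mathbf u}$, where $\tilde{\mathbf F}_1$ is the primitive idempotent (orthogonal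 projection onto eigenspace) of $\tilde{\mathbf A}$ for the eigenvalue $-(D-2)$. $\tilde{\mathbf E}_i^*$ ($0\le i\le\mathcal D$) is diagonal with $(\mathbf u,\mathbf u)$-entry $1$ if $\tilde\partial([\mathbf x],\mathbf u)=i$ and $0$ otherwise; $\tilde T$ is the algebra generated by $\tilde{\mathbf A}$ and the $\tilde{\mathbf E}^*_i$; an irreducible $\tilde T$-module is a nonzero $\tilde T$-invariant subspace of $\tilde V$ with no $\tilde T$-invariant subspaces other than $0$ and itself. ($\tilde{\mathbf C}$ is the action of $z$ under the $\mathcal A$-module structure with $x\mapsto\tilde{\mathbf A}$, $y\mapsto\tilde{\mathbf B}$, where $\mathcal A$ has relations $xy+yx=2z$, $yz+zy=2x$, $zx+xz=2y$.) Leonard triples: a square matrix is tridiagonal if all nonzero entries lie on the diagonal, sub- or superdiagonal, irreducible tridiagonal if moreover all sub- and superdiagonal entries are nonzero. For a vector space $U$ of dimension $d+1\ge1$, a Leonard triple on $U$ is an ordered triple $A,A^*,A^\varepsilon$ of linear maps $U\to U$ such that for each of the three there is a basis in which it is diagonal and the other two are irreducible tridiagonal; $d$ is the diameter. A tridiagonal $(d+1)\times(d+1)$ matrix $M$ (rows/columns indexed $0..d$) is almost bipartite if exactly one of $M_{00},M_{dd}$ is nonzero and $M_{ii}=0$ for $1\le i\le d-1$; the triple is totally almost bipartite if all six tridiagonal matrices so obtained are almost bipartite. It is of Bannai/Ito type if, for a basis $v_0,\dots,v_d$ in which $A$ is diagonal and $A^*,A^\varepsilon$ irreducible tridiagonal,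 with $Av_i=\theta_iv_i$, one has $(\theta_{i-2}-\theta_{i+1})/(\theta_{i-1}-\theta_i)=-1$ for $2\le i\le d-1$. *)

(* Defs.v *)
From HB Require Import structures.
From mathcomp Require Import all_boot all_order all_algebra.

Set Implicit Arguments.
Unset Strict Implicit.
Unset Printing Implicit Defensive.
Import Order.TTheory GRing.Theory Num.Theory.
Local Open Scope ring_scope.

Section Tridiagonal.
Variables (F : fieldType) (d : nat).
Implicit Type M : 'M[F]_d.+1.

Definition tridiagonal M : Prop :=
  forall i j : 'I_d.+1, M i j != 0 -> (i <= j.+1)%N /\ (j <= i.+1)%N.

Definition irreducible_tridiagonal M : Prop :=
  tridiagonal M /\
  forall i j : 'I_d.+1, (j = i.+1 :> nat) -> M i j != 0 /\ M j i != 0.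

(* For d = 0 the two corner entries are the same entry, and the first
   condition says that it is nonzero. *)
Definition almost_bipartite M : Prop :=
  (exists! i : 'I_d.+1, (i = ord0 \/ i = ord_max) /\ M i i != 0) /\
  (forall i : 'I_d.+1, (0 < i < d)%N -> M i i = 0).

End Tridiagonal.

Section LeonardTriple.
Variables (F : fieldType) (U : vectType F).
Implicit Types (f A As Ae : 'End(U)).

Definition diameter : nat := (\dim {:U}).-1.

(* Bases of U as tuples of length diameter.+1: such a basis exists only when
   U is nonzero. *)
Implicit Type v : (diameter.+1).-tuple U.

(* Column convention: f v_j = \sum_i M_ij v_i. *)
Definition mx_rep v f : 'M[F]_diameter.+1 :=
  \matrix_(i, j) coord v i (f v`_j).

Definition standard_basis A As Ae v : Prop :=
  [/\ basis_of fullv v, is_diag_mx (mx_rep v A),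
      irreducible_tridiagonal (mx_rep v As) &
      irreducible_tridiagonal (mx_rep v Ae)].

Definition leonard_triple A As Ae : Prop :=
  [/\ exists v, standard_basis A As Ae v,
      exists v, standard_basis As Ae A v &
      exists v, standard_basis Ae A As v].

(* Imposed on every basis of the required kind; such bases are unique up to
   reversal and rescaling of the basis vectors. *)
Definition almost_bipartite_pair A As Ae : Prop :=
  forall v, standard_basis A As Ae v ->
    almost_bipartite (mx_rep v As) /\ almost_bipartite (mx_rep v Ae).

Definition totally_almost_bipartite A As Ae : Prop :=
  [/\ almost_bipartite_pair A As Ae,
      almost_bipartite_pair As Ae A &
      almost_bipartite_pair Ae A As].

Definition bannai_ito_type A As Ae : Prop :=
  exists v, exists theta : nat -> F,
    [/\ standard_basis A As Ae v,
        (forall i : 'I_diameter.+1, A v`_i = theta i *: v`_i) &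
        (forall i : nat, (2 <= i)%N -> (i <= diameter.-1)%N ->
          (theta (i - 2)%N - theta i.+1) / (theta (i - 1)%N - theta i) = -1)].

End LeonardTriple.

Section FoldedCube.
Variable D : nat.

Definition cube : finType := {ffun 'I_D -> bool}.

Definition cube_adj (y z : cube) : bool := #|[set i | y i != z i]| == 1.

Definition antipode (y : cube) : cube := [ffun i => ~~ y i].

Definition antipodal_pair (y : cube) : {set cube} := [set y; antipode y].

Definition folded_cube : finType :=
  {u : {set cube} | [exists y, u == antipodal_pair y]}.

Fact antipodal_pairP (y : cube) :
  [exists z, antipodal_pair y == antipodal_pair z].
Proof. by apply/existsP; exists y. Qed.

Definition fclass (y : cube) : folded_cube :=
  exist _ (antipodal_pair y) (antipodal_pairP y).

(* For D = 1 the only vertex is adjacent to itself; for D >= 3 the relation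
   is irreflexive. *)
Definition fadj (u v : folded_cube) : bool :=
  [exists y in val u, exists z in val v, cube_adj y z].

End FoldedCube.

(* Path-length distance: the least n such that there is a walk of length n
   from u to v (and #|T| if v is not reachable from u). *)
Definition gdist (T : finType) (e : rel T) (u v : T) : nat :=
  find (fun n => [exists p : n.-tuple T, path e u p && (last u p == v)])
       (iota 0 #|T|).

Inductive gen_alg (C : fieldType) (n : nat) (S : 'M[C]_n -> Prop) :
  'M[C]_n -> Prop :=
| gen_alg_gen M : S M -> gen_alg S M
| gen_alg_one : gen_alg S 1%:M
| gen_alg_add M N : gen_alg S M -> gen_alg S N -> gen_alg S (M + N)
| gen_alg_scale a M : gen_alg S M -> gen_alg S (a *: M)
| gen_alg_mul M N : gen_alg S M -> gen_alg S N -> gen_alg S (M *m N).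

(* MathComp eigenspaces and projections act on row vectors; the transpositions
   give the matrix of the orthogonal projection of the space of column vectors
   onto {v | A v = a v}. *)
Definition eigenproj (C : numClosedFieldType) (n : nat) (A : 'M[C]_n) (a : C) :
  'M[C]_n := (proj_ortho (eigenspace A^T a))^T.

Section Module.
Variables (C : fieldType) (n : nat).
Implicit Types (M : 'M[C]_n) (W : {vspace 'cV[C]_n}).

Definition mx_stable M W : Prop := forall w, w \in W -> M *m w \in W.

Definition is_submodule (T : 'M[C]_n -> Prop) W : Prop :=
  forall M, T M -> mx_stable M W.

Definition irreducible_module (T : 'M[C]_n -> Prop) W : Prop :=
  [/\ W != 0%VS, is_submodule T W &
      forall U : {vspace 'cV[C]_n},
        (U <= W)%VS -> is_submodule T U -> U = 0%VS \/ U = W].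

(* The restriction of M to W, meaningful when W is M-stable. *)
Definition action_on W M : 'End(subvs_of W) :=
  linfun (vsproj W \o mulmx M \o vsval).

End Module.

(* Coordinates are indexed by 'I_#|folded_cube D| through enum_val, so that the
  standard module is 'cV[C]_#|folded_cube D|. *)

Section Terwilliger.
Variables (C : numClosedFieldType) (D : nat).
Local Notation X := (folded_cube D).

Definition adjmx : 'M[C]_#|X| :=
  \matrix_(i, j) (fadj (enum_val i) (enum_val j))%:R.

(* The Q-polynomial ordering of the eigenvalues of adjmx. *)
Definition qeigval (i : nat) : C := (-1) ^+ i * (D%:R - 2 * i%:R).

Variable x : cube D.

Definition dual_adjmx : 'M[C]_#|X| :=
  diag_mx (\row_j (#|X|%:R *
    eigenproj adjmx (qeigval 1) (enum_rank (fclass x)) j)).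

Definition dual_idem (i : nat) : 'M[C]_#|X| :=
  diag_mx (\row_j (gdist (@fadj D) (fclass x) (enum_val j) == i)%:R).

Definition third_adjmx : 'M[C]_#|X| :=
  2^-1 *: (adjmx *m dual_adjmx + dual_adjmx *m adjmx).

(* m is the diameter of the folded cube. *)
Definition terwilliger (m : nat) : 'M[C]_#|X| -> Prop :=
  gen_alg (fun M => M = adjmx \/ exists2 i, (i <= m)%N & M = dual_idem i).

End Terwilliger.

(* Main.v *)
(* Put P = A, Q = B, R = C.  These satisfy PQ + QP = 2R, QR + RQ = 2P and
   RP + PR = 2Q, and P^2 + Q^2 + R^2 is central, hence a scalar om on W.  If
   P u = th u and s = 1 or -1, then Q + s R sends u to the eigenvalue 2 s - th and
   its square multiplies u by om + 1 - (th - s)^2.  Starting from an odd integer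
   eigenvalue, alternating s = 1 and s = -1 gives eigenvalues of growing
   absolute value, so the chain stops, which forces om + 1 = (2 n)^2; chains for
   arbitrary eigenvalues then show that all eigenvalues of P, Q and R are odd
   integers.  Descending instead reaches an eigenvalue d = 1 or -1, whose
   eigenspace is stable under Q + d R; an eigenvector there starts a chain
   spanning W, on which Q and R are irreducible tridiagonal with a single nonzero
   diagonal entry, at the start of the chain.  The situation is cyclically
   symmetric in P, Q, R.

   For the folded cube, functions on the vertices are pulled back to the cube.
   The matrix B becomes multiplication by (-1)^h (D - 2 h), h being the Hamming
   distance to the base point: this is the reproducing kernel of the eigenspace,
   computed with characters.  Its value determines the distance in the folded
   cube, so that B and the dual idempotents generate each other. *)
Require Import Defs.
From mathcomp Require Import all_boot all_order all_algebra.
From mathcomp Require Import zify ring.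
Set Implicit Arguments.
Unset Strict Implicit.
Unset Printing Implicit Defensive.
Import Order.TTheory GRing.Theory Num.Theory.
Local Open Scope ring_scope.

(** * Finite-dimensional modules for the anticommutator spin relations *)

Lemma eigenvector_exists (K : numClosedFieldType) (U : vectType K)
    (f : 'End(U)) :
  {:U}%VS != 0%VS -> exists a, exists2 u, u != 0 & f u = a *: u.
Proof.
move=> U0.
have [|a] := eigenvalue_closed (passmx.mxof (vbasis {:U}) (vbasis {:U}) f).
  by rewrite lt0n dimv_eq0.
rewrite /eigenvalue -(passmx.vsof_eq0 (vbasisP _)).
rewrite -passmx.leigenspaceE ?vbasisP// => ev.
exists a; exists (vpick (passmx.leigenspace f a)); first by rewrite vpick0.
have := memv_pick (passmx.leigenspace f a).
rewrite memv_ker add_lfunE opp_lfunE scale_lfunE id_lfunE subr_eq0.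
by move/eqP.
Qed.

Lemma eigenvectors_free (K : fieldType) (U : vectType K) (f : 'End(U))
    (v : nat -> U) (a : nat -> K) (n : nat) :
    (forall i, (i < n)%N -> v i != 0) ->
    (forall i, (i < n)%N -> f (v i) = a i *: v i) ->
    (forall i j, (i < n)%N -> (j < n)%N -> a i = a j -> i = j) ->
  free (mkseq v n).
Proof.
move=> v0 fv inj.
suff H k (c : nat -> K) : (k <= n)%N -> \sum_(i < k) c i *: v i = 0 ->
    forall i, (i < k)%N -> c i = 0.
  have -> : mkseq v n = tval [tuple v i | i < n].
    by apply: (@eq_from_nth _ 0) => [|i]; rewrite size_mkseq ?size_tuple// => h;
      rewrite nth_mkseq// (nth_mktuple _ 0 (Ordinal h)).
  apply/freeP => c cv0 i.
  pose c' k := if insub k is Some j then c j else 0.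
  have := H n c' (leqnn n) _ i (ltn_ord i).
  rewrite /c' valK; apply; rewrite -[RHS]cv0; apply: eq_bigr => j _.
  by rewrite valK -tnth_nth tnth_mktuple.
elim: k c => [//|k IHk] c kn; rewrite big_ord_recr /= => s0 i.
have s1 : \sum_(j < k) (c j * (a j - a k)) *: v j = 0.
  have := congr1 f s0; rewrite linear0 linearD linear_sum /= linearZ /= fv// => s1.
  have := congr1 (fun z => a k *: z) s0; rewrite scaler0 scalerDr scaler_sumr => s2.
  move: (congr2 (fun x y => x - y) s1 s2).
  rewrite opprD addrACA !scalerA [c k * _]mulrC !subrr addr0 -sumrB => s3.
  rewrite -[RHS]s3.
  apply: eq_bigr => j _; rewrite linearZ /= fv ?(ltn_trans _ kn)//.
  by rewrite !scalerA -scalerBl; congr (_ *: _); ring.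
have ck j : (j < k)%N -> c j = 0.
  move=> jk; have /eqP := IHk (fun j => c j * (a j - a k)) (ltnW kn) s1 j jk.
  rewrite mulf_eq0 => /orP[/eqP//|].
  rewrite subr_eq0 => /eqP /(inj _ _ (ltn_trans jk kn) kn) E.
  by move: jk; rewrite E ltnn.
rewrite ltnS leq_eqVlt => /orP[/eqP ->|]; last exact: ck.
move: s0; rewrite big1 ?add0r; last by move=> j _; rewrite ck ?scale0r.
by move/eqP; rewrite scaler_eq0 (negPf (v0 _ kn)) orbF => /eqP.
Qed.

Section AnticommutatorSpin.
Variables (K : numClosedFieldType) (U : vectType K).
Implicit Types (P Q R : 'End(U)) (u : U) (s d th om : K).

Definition anticomm_spin P Q R : Prop :=
  [/\ forall u, P (Q u) + Q (P u) = 2 *: R u,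
      forall u, Q (R u) + R (Q u) = 2 *: P u &
      forall u, R (P u) + P (R u) = 2 *: Q u].

Lemma anticomm_spin_rot P Q R : anticomm_spin P Q R -> anticomm_spin Q R P.
Proof. by case=> *; split. Qed.

Definition jointly_irreducible P Q R : Prop :=
  {:U}%VS != 0%VS /\
  forall V : {vspace U}, (P @: V <= V)%VS -> (Q @: V <= V)%VS ->
    (R @: V <= V)%VS -> V = 0%VS \/ V = fullv.

Lemma jointly_irreducible_rot P Q R :
  jointly_irreducible P Q R -> jointly_irreducible Q R P.
Proof. by case=> U0 irr; split=> // V Q_V R_V P_V; apply: irr. Qed.

Definition casimir P Q R om : Prop :=
  forall u, P (P u) + Q (Q u) + R (R u) = om *: u.

Lemma casimir_rot P Q R om : casimir P Q R om -> casimir Q R P om.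
Proof. by move=> h u; rewrite -h addrC addrA. Qed.

(** Moving [P] past [Q] twice leaves the error [2 RQ - 2 QR], and moving it past [R] twice leaves
    the opposite. *)
Lemma casimir_comm P Q R : anticomm_spin P Q R ->
  forall u, P (P (P u) + Q (Q u) + R (R u)) =
            P (P (P u)) + Q (Q (P u)) + R (R (P u)).
Proof.
move=> [PQ _ RP] u.
have PQ' w : P (Q w) = 2 *: R w - Q (P w) by rewrite -PQ addrK.
have PR' w : P (R w) = 2 *: Q w - R (P w) by rewrite -RP addrAC subrr add0r.
rewrite !linearD /= -!addrA; congr (_ + _).
rewrite !(PQ', PR', linearB, linearZ) /=.
rewrite !opprK !scalerN addrACA [X in _ + X = _]addrACA addrA -opprD.
by rewrite [2 *: Q (R u) + _]addrC -[X in _ + X = _]addrA addNKr.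
Qed.

(** Schur's argument: the Casimir operator commutes with [P], [Q] and [R], so its nonzero eigenspace
    is stable under all three. *)
Lemma casimir_scalar P Q R :
  anticomm_spin P Q R -> jointly_irreducible P Q R -> exists om, casimir P Q R om.
Proof.
move=> spin [U0 irr].
pose O := ((P \o P) + (Q \o Q) + (R \o R))%VF.
have OE u : O u = P (P u) + Q (Q u) + R (R u).
  by rewrite !add_lfunE !comp_lfunE.
have [om [u u0 uE]] := eigenvector_exists O U0.
pose V := lker (O - om *: \1%VF).
have memV w : (w \in V) = (O w == om *: w).
  by rewrite memv_ker add_lfunE opp_lfunE scale_lfunE id_lfunE subr_eq0.
have stab (T : 'End(U)) : (forall w, T (O w) = O (T w)) -> (T @: V <= V)%VS.
  move=> OT; apply/subvP => _ /memv_imgP[w wV ->].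
  by rewrite memV -OT; move: wV; rewrite memV => /eqP->; rewrite linearZ.
have [|||V0|VT] := irr V.
- by apply: stab => w; rewrite !OE; apply: casimir_comm.
- have OE' w : O w = Q (Q w) + R (R w) + P (P w) by rewrite OE -addrA addrC.
  apply: stab => w; rewrite !OE'; apply: casimir_comm.
  exact: anticomm_spin_rot.
- have OE' w : O w = R (R w) + P (P w) + Q (Q w) by rewrite OE addrC addrA.
  apply: stab => w; rewrite !OE'; apply: casimir_comm.
  by do 2!apply: anticomm_spin_rot.
- by move: u0; rewrite -memv0 -V0 memV uE eqxx.
by exists om => w; rewrite -OE; apply/eqP; rewrite -memV VT memvf.
Qed.

(** * Ladder operators and chains of eigenvectors *)

Definition ladder Q R s : 'End(U) := (Q + s *: R)%VF.

Lemma ladderE Q R s u : ladder Q R s u = Q u + s *: R u.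
Proof. by rewrite add_lfunE scale_lfunE. Qed.

Lemma ladder_eigen P Q R s th u : anticomm_spin P Q R -> s ^+ 2 = 1 ->
  P u = th *: u -> P (ladder Q R s u) = (2 * s - th) *: ladder Q R s u.
Proof.
move=> [PQ _ RP] s2 Pu.
have PQ' : P (Q u) = 2 *: R u - th *: Q u by rewrite -PQ Pu linearZ addrK.
have PR' : P (R u) = 2 *: Q u - th *: R u.
  by rewrite -RP Pu linearZ /= addrAC subrr add0r.
rewrite ladderE linearD linearZ /= PQ' PR' scalerBl !scalerDr scalerN !scalerA.
rewrite -[in RHS]mulrA -expr2 s2 mulr1 [in LHS]addrACA [s * 2]mulrC.
by rewrite [X in X + _ = _]addrC opprD [s * th]mulrC.
Qed.

(** The square is [Q^2 + R^2 + s (QR + RQ)]; the Casimir relation turns the squares into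
    [om - th^2], and the cross terms give [2 s th]. *)
Lemma ladder_sqr P Q R om s th u : anticomm_spin P Q R -> casimir P Q R om ->
  s ^+ 2 = 1 -> P u = th *: u ->
  ladder Q R s (ladder Q R s u) = (om + 1 - (th - s) ^+ 2) *: u.
Proof.
move=> [_ QR _] cas s2 Pu.
have E : Q (Q u) + R (R u) = (om - th ^+ 2) *: u.
  rewrite scalerBl -cas Pu linearZ /= Pu scalerA -expr2.
  by rewrite -[_ + _ + R _]addrA addrAC subrr add0r.
rewrite !ladderE !linearD !linearZ /= !scalerA -expr2 s2 scale1r.
rewrite [s *: _ + _]addrC addrACA E -scalerDr QR Pu !scalerA -scalerDl.
by congr (_ *: _); rewrite sqrrB s2; ring.
Qed.

Lemma alt_sqr d j : d ^+ 2 = 1 -> (d * (-1) ^+ j) ^+ 2 = 1.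
Proof. by move=> d2; rewrite exprMn d2 mul1r -exprM mulnC exprM sqrrN !expr1n. Qed.

(* Alternating the two ladder operators turns an eigenvector of [P] for [d * th]
   into eigenvectors for the values [d * (-1) ^+ j * (th + 2 * j)]. *)
Fixpoint chain Q R d u j : U :=
  if j is j'.+1 then ladder Q R (- (d * (-1) ^+ j')) (chain Q R d u j') else u.

Section Chain.
Variables (P Q R : 'End(U)) (om d th : K) (u : U).
Hypotheses (spin : anticomm_spin P Q R) (cas : casimir P Q R om).
Hypotheses (d2 : d ^+ 2 = 1) (Pu : P u = (d * th) *: u).
Let s j := d * (-1) ^+ j.
Let v := chain Q R d u.

Lemma chain_eigen j : P (v j) = (s j * (th + 2 * j%:R)) *: v j.
Proof.
elim: j => [|j IHj] /=; first by rewrite Pu /s expr0 mulr1 mulr0 addr0.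
rewrite (ladder_eigen spin _ IHj) ?sqrrN ?alt_sqr//.
by congr (_ *: _); rewrite /s exprS; ring.
Qed.

Lemma chain_back j :
  ladder Q R (- s j) (v j.+1) = (om + 1 - (th + 2 * j%:R + 1) ^+ 2) *: v j.
Proof.
rewrite /= (ladder_sqr spin cas _ (chain_eigen j)) ?sqrrN ?alt_sqr//.
have -> : s j * (th + 2 * j%:R) - - s j = s j * (th + 2 * j%:R + 1) by ring.
by rewrite exprMn alt_sqr // mul1r.
Qed.

(** If the vectors of index at most [\dim {:U}] were all nonzero, their distinct eigenvalues would
    make them independent, one too many for [U]. At the last nonzero vector the factor in
    [chain_back] must vanish. *)
Lemma chain_stops : u != 0 ->
    (forall i j, (i <= \dim {:U})%N -> (j <= \dim {:U})%N ->
      s i * (th + 2 * i%:R) = s j * (th + 2 * j%:R) -> i = j) ->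
  exists k, [/\ forall i, (i <= k)%N -> v i != 0, v k.+1 = 0 &
                om + 1 = (th + 2 * k%:R + 1) ^+ 2].
Proof.
move=> u0 inj.
have ex0 : exists n, v n == 0.
  pose n := (\dim {:U}).+1.
  case: (boolP [exists i : 'I_n, v i == 0]) => [/existsP[i vi]|]; first by exists i.
  rewrite negb_exists => /forallP vn0.
  have fr : free (mkseq v n).
    apply: (eigenvectors_free (f := P) (a := fun j => s j * (th + 2 * j%:R))).
    - by move=> i ni; apply: (vn0 (Ordinal ni)).
    - by move=> i _; apply: chain_eigen.
    - by move=> i j; rewrite !ltnS; apply: inj.
  have := dim_span (mkseq v n).
  have := dimvS (subvf <<mkseq v n>>).
  by move: fr; rewrite /free => /eqP->; rewrite size_mkseq ltnn.
case: (ex_minnP ex0) => [[|k]]; first by rewrite (negPf u0).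
move=> /eqP vk0 min_k; exists k.
have vi i : (i <= k)%N -> v i != 0.
  by move=> ik; apply/negP => /min_k; rewrite ltnNge ik.
split=> //; apply/eqP; rewrite -subr_eq0.
have /eqP := chain_back k; rewrite vk0 linear0 eq_sym scaler_eq0.
by rewrite (negPf (vi k _)) // orbF.
Qed.

End Chain.

(** * Oddness of the eigenvalues *)

Lemma sign_mul_nat_inj (a b : K) m n : a ^+ 2 = 1 -> b ^+ 2 = 1 ->
  a * m%:R = b * n%:R -> m = n.
Proof.
move=> a2 b2 /(congr1 (fun x => x ^+ 2)).
rewrite !exprMn a2 b2 !mul1r -!natrX => /eqP; rewrite eqr_nat eqn_exp2r//.
by move/eqP.
Qed.

Lemma odd_chain_stops P Q R om d j u : anticomm_spin P Q R -> casimir P Q R om ->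
    d ^+ 2 = 1 -> u != 0 -> P u = (d * (2 * j + 1)%:R) *: u ->
  exists k, [/\ forall i, (i <= k)%N -> chain Q R d u i != 0,
    chain Q R d u k.+1 = 0 & om + 1 = (2 * (j + k).+1)%:R ^+ 2].
Proof.
move=> spin cas d2 u0 Pu.
have [|k [v0 vk1 omE]] := chain_stops spin cas d2 Pu u0.
  move=> i i' _ _; rewrite -!natrM -!natrD.
  by move/(sign_mul_nat_inj (alt_sqr i d2) (alt_sqr i' d2)); lia.
exists k; split=> //; rewrite omE -natrM -natrD natr1; congr (_%:R ^+ 2); lia.
Qed.

(** Either the chain from [th] has distinct eigenvalues long enough to stop, and then [th + 2 k + 1]
    is [2 n] or [- 2 n]; or two of its eigenvalues coincide, which already determines [th]. *)
Lemma eigenvalue_odd P Q R om n th u :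
    anticomm_spin P Q R -> casimir P Q R om -> om + 1 = (2 * n)%:R ^+ 2 ->
    u != 0 -> P u = th *: u ->
  exists d, exists2 j, d ^+ 2 = 1 & th = d * (2 * j + 1)%:R.
Proof.
move=> spin cas omE u0 Pu.
pose m := (\dim {:U}).+1.
pose a i : K := 1 * (-1) ^+ i * (th + 2 * i%:R).
case: (boolP [forall i : 'I_m, forall j : 'I_m, (a i == a j) ==> (i == j)]).
  move=> /forallP inj.
  have [||i j im jm eqa|k [_ _]] := chain_stops spin cas (d := 1) (th := th) _ _ u0.
  - by rewrite expr1n.
  - by rewrite mul1r.
  - move/forallP/(_ (Ordinal (jm : (j < m)%N)))/implyP: (inj (Ordinal (im : (i < m)%N))).
    by move=> /(_ (introT eqP eqa)) /eqP/(congr1 val).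
  rewrite omE => /eqP; rewrite eqf_sqr => /orP[] /eqP E.
    have -> : th = (2 * n)%:R - (2 * k + 1)%:R.
      by rewrite E natrD natrM; ring.
    have [kn|nk] := ltnP k n.
      exists 1, (n - k.+1)%N; rewrite ?expr1n// mul1r -natrB; last by lia.
      by congr _%:R; lia.
    exists (-1), (k - n)%N; rewrite ?sqrrN ?expr1n// mulN1r -opprB -natrB; last by lia.
    by congr (- _%:R); lia.
  exists (-1), (n + k)%N; first by rewrite sqrrN expr1n.
  have -> : th = - (2 * n)%:R - (2 * k + 1)%:R by rewrite E natrD natrM; ring.
  by rewrite mulN1r -opprD -natrD; congr (- _%:R); lia.
rewrite negb_forall => /existsP[i]; rewrite negb_forall => /existsP[j].
rewrite negb_imply => /andP[/eqP eqa nij].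
have {}eqa : (-1) ^+ (odd i) * (th + 2 * i%:R) = (-1) ^+ (odd j) * (th + 2 * j%:R).
  by move: eqa; rewrite /a !mul1r -!(signr_odd _ i) -!(signr_odd _ j).
have [oddij|evenij] := boolP (odd (i + j)); last first.
  have E : odd i = odd j by move: evenij; rewrite oddD; case: odd; case: odd.
  move: eqa; rewrite E => /(mulfI _); rewrite signr_eq0 => /(_ isT)/addrI/eqP.
  by rewrite -!natrM eqr_nat => /eqP E'; case/negP: nij; apply/eqP/val_inj => /=; lia.
(* For [i + j] odd the coincidence reads [th + 2 i = - (th + 2 j)], that is, [th = - (i + j)]. *)
exists (-1), ((i + j)./2); first by rewrite sqrrN expr1n.
have E' : th + 2 * i%:R = - (th + 2 * j%:R).
  move: oddij eqa; rewrite oddD; case: (odd i); case: (odd j) => //= _.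
    by rewrite expr0 expr1 mul1r mulN1r => <-; rewrite opprK.
  by rewrite expr0 expr1 mul1r mulN1r.
have -> : (2 * (i + j)./2 + 1)%N = (i + j)%N.
  by rewrite -[RHS]odd_double_half oddij; lia.
have two0 : (2 : K) != 0 by rewrite pnatr_eq0.
apply: (mulfI two0).
have -> : 2 * th = (th + 2 * i%:R) + (th + 2 * j%:R) - 2 * (i%:R + j%:R) by ring.
by rewrite E' natrD; ring.
Qed.

(** With the ladder sign [d], opposite to that of the chain, the eigenvalue [d (2 j + 3)] becomes
    [- d (2 j + 1)], smaller by 2 in absolute value. *)
Lemma eigenvalue_descend P Q R om d j u :
    anticomm_spin P Q R -> casimir P Q R om ->
    d ^+ 2 = 1 -> u != 0 -> P u = (d * (2 * j + 1)%:R) *: u ->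
  exists d', exists2 u', d' ^+ 2 = 1 & u' != 0 /\ P u' = d' *: u'.
Proof.
move=> spin cas; elim: j d u => [|j IHj] d u d2 u0 Pu.
  by exists d, u => //; split=> //; rewrite Pu mulr1.
have [k [_ _ omE]] := odd_chain_stops spin cas d2 u0 Pu.
have sq := ladder_sqr spin cas d2 Pu.
apply: (IHj (- d) (ladder Q R d u)); first by rewrite sqrrN.
  (* The image is nonzero: the ascending chain gives [om + 1 = (2 (j + k + 2))^2], which differs
     from [(2 (j + 1))^2]. *)
  apply/eqP => y0; move/eqP: sq; rewrite y0 linear0 eq_sym scaler_eq0 (negPf u0).
  have -> : d * (2 * j.+1 + 1)%:R - d = d * (2 * j.+1)%:R.
    by rewrite natrD; ring.
  rewrite orbF exprMn d2 mul1r omE subr_eq0 -!natrX eqr_nat eqn_exp2r//.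
  by move/eqP; lia.
rewrite (ladder_eigen spin d2 Pu); congr (_ *: _).
by rewrite !natrD !natrM -natr1; ring.
Qed.

(** * Eigenbases on which the other two maps are tridiagonal *)

(* The predecessor is truncated: at [i = 0] the second term is [b 0 *: v 0],
   the only diagonal entry of the matrix of [T]. *)
Definition two_term (T : 'End(U)) (v : nat -> U) n : Prop :=
  exists a b : nat -> K, forall i, (i < n)%N ->
    [/\ a i != 0, b i != 0 & T (v i) = a i *: v i.+1 + b i *: v i.-1].

(** At the last index the successor term of [two_term] is the default 0 of [nth], so the end of the
    basis needs no separate case. *)
Definition odd_basis P Q R d (e : (diameter U).+1.-tuple U) : Prop :=
  [/\ basis_of fullv e, d ^+ 2 = 1,
      forall i : 'I_(diameter U).+1,
        P e`_i = (d * (-1) ^+ i * (2 * i + 1)%:R) *: e`_i,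
      two_term Q (nth 0 e) (diameter U).+1 &
      two_term R (nth 0 e) (diameter U).+1].

(** For [th = s = d] the ladder operator [Y] preserves the eigenspace and has square [om + 1 = l^2]
    there. So [Y u + l u] has eigenvalue [l] under [Y], unless it is zero and [u] itself has
    eigenvalue [- l]. *)
Lemma ladder_eigenvector P Q R om d n u : anticomm_spin P Q R ->
    casimir P Q R om -> d ^+ 2 = 1 -> om + 1 = (2 * n)%:R ^+ 2 ->
    u != 0 -> P u = d *: u ->
  exists l, exists2 w, l ^+ 2 = om + 1 &
    [/\ w != 0, P w = d *: w & ladder Q R d w = l *: w].
Proof.
move=> spin cas d2 omE u0 Pu; pose l := (2 * n)%:R : K.
have PY : P (ladder Q R d u) = d *: ladder Q R d u.
  by rewrite (ladder_eigen spin d2 Pu); congr (_ *: _); ring.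
have YY := ladder_sqr spin cas d2 Pu.
have [/eqP|w0] := eqVneq (ladder Q R d u + l *: u) 0.
  rewrite addr_eq0 => /eqP Yu; exists (- l), u; first by rewrite sqrrN omE.
  by split=> //; rewrite Yu scaleNr.
exists l, (ladder Q R d u + l *: u); first by rewrite omE.
split=> //; first by rewrite linearD linearZ /= PY Pu scalerDr !scalerA mulrC.
rewrite linearD linearZ /= YY subrr expr0n subr0 omE scalerDr scalerA expr2.
by rewrite addrC.
Qed.

(** The ladder operator of sign [- s i] raises [v i]; the one of sign [s i] lowers it, or multiplies
    it by [l] if [i = 0]. Half their sum is [Q], and [s i / 2] times their difference is [R]. *)
Lemma two_term_chain P Q R om d l k u : anticomm_spin P Q R ->
    casimir P Q R om -> d ^+ 2 = 1 -> P u = d *: u ->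
    ladder Q R d u = l *: u -> l ^+ 2 = om + 1 -> om + 1 = (2 * k.+1)%:R ^+ 2 ->
  two_term Q (chain Q R d u) k.+1 /\ two_term R (chain Q R d u) k.+1.
Proof.
move=> spin cas d2 Pu Yu l2 omE; pose s i := d * (-1) ^+ i; pose v := chain Q R d u.
have s2 i : s i ^+ 2 = 1 by exact: alt_sqr.
have s0 i : s i != 0 by rewrite -sqrf_eq0 s2 oner_eq0.
have Pu' : P u = (d * 1) *: u by rewrite mulr1.
pose c i := if i is i'.+1 then om + 1 - (1 + 2 * i'%:R + 1) ^+ 2 else l.
(* For [0 < i <= k] this coefficient is [(2 (k + 1))^2 - (2 i)^2]. *)
have c0 i : (i < k.+1)%N -> c i != 0.
  case: i => [_|i ik] /=; first by rewrite -sqrf_eq0 l2 omE sqrf_eq0 pnatr_eq0.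
  have -> : 1 + 2 * i%:R + 1 = (2 * i.+1)%:R :> K by rewrite natrM -natr1; ring.
  by rewrite omE subr_eq0 -!natrX eqr_nat eqn_exp2r//; lia.
have up i : ladder Q R (- s i) (v i) = v i.+1 by [].
have down i : ladder Q R (s i) (v i) = c i *: v i.-1.
  case: i => [|i] /=; first by rewrite /s mulr1 Yu.
  rewrite -(chain_back spin cas d2 Pu'); congr (ladder _ _ _ _).
  by rewrite /s exprS; ring.
have two0 : (2 : K) != 0 by rewrite pnatr_eq0.
have h0 : (2^-1 : K) != 0 by rewrite invr_eq0.
have QE i : Q (v i) = 2^-1 *: v i.+1 + (2^-1 * c i) *: v i.-1.
  rewrite -scalerA -down -up !ladderE -scalerDr scaleNr addrACA addNr addr0.
  by rewrite -mulr2n -scaler_nat scalerA mulVf ?scale1r.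
have RE i : R (v i) = (- (s i / 2)) *: v i.+1 + (s i / 2 * c i) *: v i.-1.
  rewrite -scalerA -down -up !ladderE scaleNr addrC -scalerBr opprD addrACA subrr.
  rewrite add0r scaleNr opprK -mulr2n -scaler_nat !scalerA -[_ * 2 * _]mulrA.
  by rewrite mulrA divfK // -expr2 s2 scale1r.
split.
  exists (fun=> 2^-1), (fun i => 2^-1 * c i) => i ik.
  by split; rewrite ?mulf_neq0 ?c0.
exists (fun i => - (s i / 2)), (fun i => s i / 2 * c i) => i ik.
have h1 : s i / 2 != 0 by rewrite mulf_neq0.
by split; rewrite ?oppr_eq0 ?(mulf_neq0 h1) ?c0.
Qed.

Lemma two_term_stable (T : 'End(U)) (v : nat -> U) n : two_term T v n ->
  v n = 0 -> (T @: <<mkseq v n>> <= <<mkseq v n>>)%VS.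
Proof.
move=> [a [b ab]] vn.
have memv_v i : (i <= n)%N -> v i \in <<mkseq v n>>%VS.
  rewrite leq_eqVlt => /orP[/eqP->|ni]; first by rewrite vn mem0v.
  by apply: memv_span; apply/mapP; exists i => //; rewrite mem_iota.
rewrite limg_span; apply/span_subvP => _ /mapP[_ /mapP[i + ->] ->].
rewrite mem_iota add0n => /= ni; have [_ _ ->] := ab i ni.
by rewrite memvD // memvZ // memv_v // (leq_trans (leq_pred i)) // ltnW.
Qed.

Lemma odd_basis_exists P Q R om d0 j u : anticomm_spin P Q R ->
    jointly_irreducible P Q R -> casimir P Q R om ->
    d0 ^+ 2 = 1 -> u != 0 -> P u = (d0 * (2 * j + 1)%:R) *: u ->
  exists d e, odd_basis P Q R d e /\ om + 1 = (2 * (diameter U).+1)%:R ^+ 2.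
Proof.
move=> spin [_ irr] cas d02 u0 Pu.
have [d [w d2 [w0 Pw]]] := eigenvalue_descend spin cas d02 u0 Pu.
have Pd1 z : P z = d *: z -> P z = (d * (2 * 0 + 1)%:R) *: z by rewrite mulr1.
(* This first chain serves to exhibit [om + 1] as an even square, whose root gives the eigenvalue
   [l] of the ladder operator. *)
have [n [_ _ omn]] := odd_chain_stops spin cas d2 w0 (Pd1 _ Pw).
have [l [z l2 [z0 Pz Yz]]] := ladder_eigenvector spin cas d2 omn w0 Pw.
have [k [v0 vk1 omk]] := odd_chain_stops spin cas d2 z0 (Pd1 _ Pz).
have [Qv Rv] := two_term_chain spin cas d2 Pz Yz l2 omk.
set v := chain Q R d z in v0 vk1 Qv Rv.
have Pz' : P z = (d * 1) *: z by rewrite mulr1.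
have Pv i : P (v i) = (d * (-1) ^+ i * (2 * i + 1)%:R) *: v i.
  by rewrite (chain_eigen spin d2 Pz') natrD natrM addrC.
clearbody v.
have fr : free (mkseq v k.+1).
  apply: (eigenvectors_free (f := P) (a := fun i => d * (-1) ^+ i * (2 * i + 1)%:R)) => //.
  move=> i i' _ _ /(sign_mul_nat_inj (alt_sqr i d2) (alt_sqr i' d2)); lia.
have spanT : <<mkseq v k.+1>>%VS = fullv.
  have [|||V0|//] := irr <<mkseq v k.+1>>%VS; try exact: two_term_stable.
    rewrite limg_span; apply/span_subvP => _ /mapP[_ /mapP[i + ->] ->].
    by move=> ik; rewrite Pv memvZ // memv_span // map_f.
  have : v 0 \in <<mkseq v k.+1>>%VS by apply: memv_span; apply: map_f.
  by rewrite V0 memv0 (negPf (v0 _ _)).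
have dimU : (diameter U).+1 = k.+1.
  by rewrite /diameter -spanT (eqP fr) size_mkseq.
have sz : size (mkseq v k.+1) == (diameter U).+1 by rewrite size_mkseq dimU.
(* At [i = k.+1] both sides are 0: the default of [nth] and the end of the chain. *)
have ev i : (i <= k.+1)%N -> (mkseq v k.+1)`_i = v i.
  rewrite leq_eqVlt => /orP[/eqP->|?]; last by rewrite nth_mkseq.
  by rewrite vk1 nth_default ?size_mkseq.
exists d, (Tuple sz); split; last by rewrite dimU omk.
move: (mkseq v k.+1) sz ev fr spanT => e sz ev fr spanT.
have tt T : two_term T v k.+1 -> two_term T (nth 0 (Tuple sz)) (diameter U).+1.
  move=> [a [b ab]]; exists a, b => i ik; rewrite dimU in ik.
  have [ai bi E] := ab i ik; split=> //; rewrite [tval _]/=.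
  rewrite (ev i.+1 ik) (ev i (ltnW ik)) E ev //.
  by rewrite (leq_trans (leq_pred i)) // ltnW.
split=> //; try exact: tt.
  by rewrite basisEfree fr spanT subvv /= -spanT (eqP fr).
by move=> i; rewrite /= ev ?Pv // ltnW // -dimU.
Qed.

(** * Matrices in eigenbases and Leonard triples *)

Lemma coord_nth n (e : n.-tuple U) (i : 'I_n) j :
  free e -> coord e i e`_j = (j == i)%:R.
Proof.
move=> fr; have [jn|nj] := ltnP j n; first exact: (coord_free (Ordinal jn) i fr).
rewrite nth_default ?size_tuple// linear0.
by case: eqP nj => // ->; rewrite leqNgt ltn_ord.
Qed.

Lemma mx_rep_two_term (T : 'End(U)) (e : (diameter U).+1.-tuple U) :
    free e -> two_term T (nth 0 e) (diameter U).+1 ->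
  irreducible_tridiagonal (mx_rep e T) /\
  forall i, (mx_rep e T i i != 0) = (i == ord0).
Proof.
move=> fr [a [b ab]].
(* Column [j] lives in rows [j.+1] and [j.-1]; for [j = 0] the truncated predecessor puts the second
   entry on the diagonal. *)
have E i j : mx_rep e T i j = a j * (j.+1 == i)%:R + b j * (j.-1 == i)%:R.
  have [_ _ Te] := ab j (ltn_ord j).
  by rewrite mxE Te linearD !linearZ /= !coord_nth.
split; first split.
- move=> i j; rewrite E; have [ji _|_] := eqVneq j.+1 i; first by lia.
  have [ji _|_] := eqVneq j.-1 i; first by lia.
  by rewrite !mulr0 addr0 eqxx.
- move=> i j ji; have [_ bj _] := ab j (ltn_ord j); have [ai _ _] := ab i (ltn_ord i).
  rewrite !E ji /= eqxx.
  have -> : (i.+2 == i) = false by apply/eqP; lia.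
  have -> : (i.-1 == i.+1) = false by apply/eqP; lia.
  by rewrite eqxx !mulr0 !mulr1 addr0 add0r; rewrite -?ji.
move=> i; have [_ bi _] := ab i (ltn_ord i); rewrite E gtn_eqF// mulr0 add0r.
have -> : (i.-1 == i) = (i == ord0).
  by rewrite -(inj_eq val_inj) /=; case: (val i) => [|k] //=; rewrite ltn_eqF.
by case: (i == ord0); rewrite ?mulr1 ?mulr0 ?bi ?eqxx.
Qed.

(* A second eigenbasis of [P] is a permutation [sg] of the first one up to
   scaling; since tridiagonality makes [sg] preserve the path structure, the
   nonzero diagonal entry must stay at an end of the path. *)
Lemma almost_bipartite_any_basis P (T : 'End(U)) (a : 'I_(diameter U).+1 -> K)
    (e e' : (diameter U).+1.-tuple U) :
    basis_of fullv e -> injective a -> (forall i : 'I_(diameter U).+1, P e`_i = a i *: e`_i) ->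
    tridiagonal (mx_rep e T) ->
    (forall i, (mx_rep e T i i != 0) = (i == ord0)) ->
    basis_of fullv e' -> is_diag_mx (mx_rep e' P) ->
    irreducible_tridiagonal (mx_rep e' T) ->
  almost_bipartite (mx_rep e' T).
Proof.
move=> eb inj_a Pe tri diag eb' /is_diag_mxP dg' [tri' irr'].
have fr := basis_free eb; have fr' := basis_free eb'.
have Pe' (i : 'I_(diameter U).+1) : P e'`_i = mx_rep e' P i i *: e'`_i.
  rewrite [LHS](coord_basis eb') ?memvf// (bigD1 i) //= big1 ?addr0 ?mxE// => j ji.
  by have := dg' j i; rewrite mxE => ->; rewrite ?scale0r// (inj_eq val_inj).
(* The values of [a] are distinct, so an eigenvector of [P] has a single nonzero coordinate in
   [e]. *)
have colin (i : 'I_(diameter U).+1) :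
      exists k : 'I_(diameter U).+1, exists2 c, c != 0 & e'`_i = c *: e`_k.
  have [k ck] : exists k, coord e k e'`_i != 0.
    apply/existsP; apply: contraT; rewrite negb_exists => /forallP c0.
    have : e'`_i != 0 by rewrite (free_not0 fr') ?mem_nth ?size_tuple.
    rewrite [e'`_i](coord_basis eb) ?memvf// big1 ?eqxx// => k _.
    by have := c0 k; rewrite negbK => /eqP->; rewrite scale0r.
  have ak j : a j * coord e j e'`_i = mx_rep e' P i i * coord e j e'`_i.
    have /(congr1 (coord e j)) := Pe' i; rewrite linearZ /= => <-.
    rewrite [e'`_i in RHS](coord_basis eb) ?memvf// linear_sum linear_sum /=.
    rewrite (bigD1 j) //= big1 ?addr0 => [|l lj].
      by rewrite linearZ /= Pe !linearZ /= coord_nth// eqxx mulr1 mulrC.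
    by rewrite linearZ /= Pe !linearZ /= coord_nth// (inj_eq val_inj) (negPf lj) !mulr0.
  exists k, (coord e k e'`_i) => //.
  rewrite [LHS](coord_basis eb) ?memvf// (bigD1 k) //= big1 ?addr0// => j jk.
  have [->|cj] := eqVneq (coord e j e'`_i) 0; first by rewrite scale0r.
  by case/eqP: jk; apply: inj_a; rewrite (mulIf cj (ak j)) (mulIf ck (ak k)).
have [sg {colin}/fin_all_exists2 [c c0 ce]] := fin_all_exists colin.
have inj_sg : injective sg.
  move=> i j sij; have [//|ij] := eqVneq i j.
  have := congr1 (coord e' i) (ce i); rewrite coord_nth// eqxx linearZ /= => Ei.
  have := congr1 (coord e' i) (ce j); rewrite -sij coord_nth// (inj_eq val_inj).
  rewrite eq_sym (negPf ij) linearZ /= => /esym/eqP.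
  rewrite mulf_eq0 (negPf (c0 j)) /= => /eqP z.
  by move/eqP: Ei; rewrite z mulr0 oner_eq0.
have ME i j : (mx_rep e' T i j != 0) = (mx_rep e T (sg i) (sg j) != 0).
  have : mx_rep e' T i j * c i = c j * mx_rep e T (sg i) (sg j).
    rewrite !mxE -[in RHS]linearZ /= -linearZ /= -ce.
    rewrite [T e'`_j in RHS](coord_basis eb') ?memvf// linear_sum /=.
    rewrite (bigD1 i) //= big1 ?addr0 => [|l li].
      by rewrite linearZ /= [e'`_i]ce linearZ /= coord_nth// eqxx mulr1.
    rewrite linearZ /= [e'`_l]ce linearZ /= coord_nth// (inj_eq val_inj) (inj_eq inj_sg).
    by rewrite (negPf li) !mulr0.
  move=> E; apply/idP/idP; apply: contraNneq => z; move/eqP: E; rewrite z ?mulr0 ?mul0r.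
    by rewrite mulf_eq0 (negPf (c0 i)) orbF.
  by rewrite eq_sym mulf_eq0 (negPf (c0 j)).
pose i0 := invF inj_sg ord0.
have sg0 : sg i0 = ord0 by rewrite /i0 f_invF.
have dg i : (mx_rep e' T i i != 0) = (i == i0).
  by rewrite ME diag -sg0 (inj_eq inj_sg).
(* An interior [i0] would have two neighbours, which [sg] would send to distinct neighbours of 0;
   the path has only one. *)
have end0 : i0 = ord0 \/ i0 = ord_max.
  have [z|p0] := posnP i0; first by left; apply: val_inj.
  have [lt|ge] := ltnP i0 (diameter U); last first.
    by right; apply: val_inj => /=; have := ltn_ord i0; lia.
  have pl : (i0.-1 < (diameter U).+1)%N by lia.
  have pr : (i0.+1 < (diameter U).+1)%N by lia.
  have [_] := irr' (Ordinal pl) i0 (esym (prednK p0)).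
  have [+ _] := irr' i0 (Ordinal pr) erefl.
  rewrite !ME sg0 => /tri[_ r1] /tri[_ l1].
  have ne k : k != i0 -> sg k != 0 :> nat.
    by move=> ki; rewrite (inj_eq val_inj (sg k) ord0) -sg0 (inj_eq inj_sg).
  have nl : sg (Ordinal pl) != 0 :> nat by apply: ne; rewrite -(inj_eq val_inj) /=; lia.
  have nr : sg (Ordinal pr) != 0 :> nat by apply: ne; rewrite -(inj_eq val_inj) /=; lia.
  have /inj_sg/(congr1 val) /= : sg (Ordinal pl) = sg (Ordinal pr).
    by apply: val_inj; move: r1 l1 nl nr => /=; lia.
  lia.
split; first by exists i0; split=> [|j [_]]; rewrite dg // => /eqP.
move=> i /andP[i_gt0 ltid]; apply/eqP; apply: contraTT isT; rewrite dg => /eqP E.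
by case: end0 => E'; move: i_gt0 ltid; rewrite E E' /= ?ltnn.
Qed.

Lemma odd_basis_standard P Q R d e : odd_basis P Q R d e -> standard_basis P Q R e.
Proof.
move=> [eb d2 Pe /(mx_rep_two_term (basis_free eb))[Qe _]].
move=> /(mx_rep_two_term (basis_free eb))[Re _]; split=> //.
apply/is_diag_mxP => i j ij; rewrite mxE Pe linearZ /= coord_nth ?(basis_free eb)//.
by rewrite eq_sym (negPf ij) mulr0.
Qed.

Lemma odd_basis_almost_bipartite P Q R d e :
  odd_basis P Q R d e -> almost_bipartite_pair P Q R.
Proof.
move=> [eb d2 Pe /(mx_rep_two_term (basis_free eb))[[Qe _] Qd]].
move=> /(mx_rep_two_term (basis_free eb))[[Re _] Rd] e' [eb' dg' Q' R'].
pose a (i : 'I_(diameter U).+1) := d * (-1) ^+ i * (2 * i + 1)%:R.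
have inj_a : injective a.
  move=> i j /(sign_mul_nat_inj (alt_sqr i d2) (alt_sqr j d2)) ij.
  by apply: val_inj => /=; lia.
by split; apply: (almost_bipartite_any_basis (P := P) (a := a) (e := e)).
Qed.

(** Four consecutive eigenvalues are [s (2 i + 1)], [- s (2 i + 3)], [s (2 i + 5)], [- s (2 i + 7)]:
    the outer difference is [(4 i + 8) s] and the inner one its opposite. *)
Lemma odd_basis_bannai_ito P Q R d e : odd_basis P Q R d e -> bannai_ito_type P Q R.
Proof.
move=> ob; have [eb d2 Pe _ _] := ob.
exists e, (fun i => d * (-1) ^+ i * (2 * i + 1)%:R).
split=> //; first exact: odd_basis_standard ob.
case=> [|[|i]] // _ _; rewrite !subSS subn0 !exprS.
have : d * (-1) ^+ i != 0 by rewrite -sqrf_eq0 alt_sqr// oner_eq0.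
set s := d * _ => s0.
have -> : s * (2 * i + 1)%:R - d * (-1 * (-1 * (-1 * (-1) ^+ i))) * (2 * i.+3 + 1)%:R
    = (4 * i.+2)%:R * s by rewrite /s !natrD !natrM; ring.
have -> : d * (-1 * (-1) ^+ i) * (2 * i.+1 + 1)%:R
   - d * (-1 * (-1 * (-1) ^+ i)) * (2 * i.+2 + 1)%:R = - ((4 * i.+2)%:R * s).
  by rewrite /s !natrD !natrM; ring.
by rewrite invrN mulrN divff // mulf_neq0 // pnatr_eq0.
Qed.

(** The odd eigenvalue is asked of [Q], which is the diagonal map in the application. It makes
    [om + 1] an even square, from which [eigenvalue_odd] gets odd eigenvalues of [P] and [R]. *)
Lemma anticomm_spin_leonard P Q R d j u : anticomm_spin P Q R ->
    jointly_irreducible P Q R ->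
    d ^+ 2 = 1 -> u != 0 -> Q u = (d * (2 * j + 1)%:R) *: u ->
  [/\ leonard_triple P Q R, totally_almost_bipartite P Q R &
      bannai_ito_type P Q R].
Proof.
move=> spin irr d2 u0 Qu.
have [om cas] := casimir_scalar spin irr.
have spinQ := anticomm_spin_rot spin; have spinR := anticomm_spin_rot spinQ.
have irrQ := jointly_irreducible_rot irr; have irrR := jointly_irreducible_rot irrQ.
have casQ := casimir_rot cas; have casR := casimir_rot casQ.
have [dQ [eQ [obQ omE]]] := odd_basis_exists spinQ irrQ casQ d2 u0 Qu.
have [th [w w0 Pw]] := eigenvector_exists P (proj1 irr).
have [dP' [jP dP'2 thE]] := eigenvalue_odd spin cas omE w0 Pw; rewrite thE in Pw.
have [dP [eP [obP _]]] := odd_basis_exists spin irr cas dP'2 w0 Pw.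
have [th' [z z0 Rz]] := eigenvector_exists R (proj1 irr).
have [dR' [jR dR'2 thE']] := eigenvalue_odd spinR casR omE z0 Rz; rewrite thE' in Rz.
have [dR [eR [obR _]]] := odd_basis_exists spinR irrR casR dR'2 z0 Rz.
split; last exact: odd_basis_bannai_ito obP.
  split; [exists eP | exists eQ | exists eR]; apply: odd_basis_standard; eassumption.
by split; apply: odd_basis_almost_bipartite; eassumption.
Qed.
End AnticommutatorSpin.

(** * The folded cube and its distance *)

Section FoldedCubeGraph.
Variable D : nat.
Implicit Types (x y z : cube D) (u : folded_cube D).

Definition flip (a : 'I_D) y : cube D := [ffun b => y b (+) (b == a)].

Lemma flipK a : involutive (flip a).
Proof. by move=> y; apply/ffunP => b; rewrite !ffunE -addbA addbb addbF. Qed.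

Lemma flipC a b y : flip a (flip b y) = flip b (flip a y).
Proof. by apply/ffunP => c; rewrite !ffunE addbAC. Qed.

Lemma antipode_flip a y : antipode (flip a y) = flip a (antipode y).
Proof. by apply/ffunP => b; rewrite !ffunE addNb. Qed.

Lemma antipodeK : involutive (@antipode D).
Proof. by move=> y; apply/ffunP => b; rewrite !ffunE negbK. Qed.

Lemma cube_adjP y z : reflect (exists a, z = flip a y) (cube_adj y z).
Proof.
apply: (iffP cards1P) => [[a E]|[a ->]].
  exists a; apply/ffunP => b; move/setP/(_ b): E; rewrite !inE ffunE => <-.
  by case: (y b); case: (z b).
exists a; apply/setP => b; rewrite !inE ffunE.
by case: (b == a); case: (y b).
Qed.

Lemma mem_fclass y z : (z \in val (fclass y)) = (z == y) || (z == antipode y).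
Proof. by rewrite !inE. Qed.

Lemma fclass_antipode y : fclass (antipode y) = fclass y.
Proof.
by apply/val_inj/setP => z; rewrite !mem_fclass antipodeK orbC.
Qed.

Lemma fclass_eq y z : (fclass z == fclass y) = (z == y) || (z == antipode y).
Proof.
apply/eqP/idP => [E|/orP[] /eqP->] //; last exact: fclass_antipode.
by rewrite -mem_fclass -E mem_fclass eqxx.
Qed.

Lemma fclass_surj u : exists y, u = fclass y.
Proof.
by have /existsP[y /eqP uy] := valP u; exists y; apply: val_inj.
Qed.

Lemma fadjP y u : reflect (exists a, u = fclass (flip a y)) (fadj (fclass y) u).
Proof.
apply: (iffP exists_inP) => [[y' yy' /exists_inP[z zu /cube_adjP[a za]]]|[a ->]].
  have [w uw] := fclass_surj u; exists a.
  have -> : u = fclass z.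
    by apply/esym/eqP; rewrite uw fclass_eq -mem_fclass -uw.
  move: yy'; rewrite mem_fclass za => /orP[] /eqP-> //.
  by rewrite -antipode_flip fclass_antipode.
exists y; first by rewrite mem_fclass eqxx.
apply/exists_inP; exists (flip a y); first by rewrite mem_fclass eqxx.
by apply/cube_adjP; exists a.
Qed.

Lemma fadj_sym : symmetric (@fadj D).
Proof.
suff H u v : fadj u v -> fadj v u by move=> u v; apply/idP/idP; apply: H.
have [y ->] := fclass_surj u => /fadjP[a ->].
by apply/fadjP; exists a; rewrite flipK.
Qed.

(** If flips at distinct [a] and [b] gave antipodal vertices, every coordinate would be [a] or [b],
    forcing [D = 2]. *)
Lemma fclass_flip_inj y : odd D -> injective (fun a => fclass (flip a y)).
Proof.
move=> oddD a b /eqP; rewrite fclass_eq => /orP[] /eqP/ffunP E.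
  by have := E a; rewrite !ffunE eqxx => /addbI/esym/eqP.
apply/eqP; apply: contraTT oddD => ab.
have all2 c : (c == a) || (c == b).
  by have := E c; rewrite !ffunE; case: (y c); case: (c == a); case: (c == b).
have : #|'I_D| = #|[set a; b]|.
  by apply: eq_card => c; rewrite !inE all2.
by rewrite card_ord cards2 ab => ->.
Qed.

Definition hdist x y : nat := #|[set a | x a != y a]|.

Lemma hdist_antipode x y : hdist x (antipode y) = (D - hdist x y)%N.
Proof.
have := cardsC [set a | x a != y a]; rewrite card_ord => E.
transitivity #|~: [set a | x a != y a]|; last by rewrite /hdist; lia.
apply: eq_card => a; by rewrite !inE ffunE; case: (x a); case: (y a).
Qed.

Lemma hdist_le x y : (hdist x y <= D)%N.
Proof. by rewrite -[X in (_ <= X)%N]card_ord max_card. Qed.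

Lemma hdist_flip a x y :
  (if x a != y a then hdist (flip a x) y = (hdist x y).-1
   else hdist (flip a x) y = (hdist x y).+1) /\ (x a != y a -> 0 < hdist x y)%N.
Proof.
rewrite /hdist; split; last by move=> xya; apply/card_gt0P; exists a; rewrite inE.
case: ifPn => xya.
  rewrite (cardsD1 a [set b | x b != y b]) inE xya /=; apply: eq_card => b.
  by rewrite !inE ffunE; have [->|_] := eqVneq b a; rewrite ?addbT ?addbF//; case: (x a) xya; case: (y a).
rewrite (cardsD1 a [set b | flip a x b != y b]) inE ffunE eqxx addbT.
have -> : ~~ x a != y a by case: (x a) xya; case: (y a).
rewrite add1n; congr _.+1; apply: eq_card => b; rewrite !inE ffunE.
have [->|_] := eqVneq b a; rewrite ?addbF//=.
by case: (x a) xya; case: (y a).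
Qed.

(** Each step changes the Hamming distance by one, hence the minimum by at most one. *)
Lemma walk_lower x y (p : seq (folded_cube D)) :
  path (@fadj D) (fclass x) p -> last (fclass x) p = fclass y ->
  (minn (hdist x y) (D - hdist x y) <= size p)%N.
Proof.
elim: p x => [|u p IHp] x /=.
  move=> _ /eqP; rewrite fclass_eq => /orP[] /eqP ->.
    have -> : hdist y y = 0 by apply: eq_card0 => a; rewrite inE eqxx.
    by rewrite min0n.
  have -> : hdist (antipode y) y = D.
    by rewrite -[RHS]card_ord; apply: eq_card => a; rewrite !inE ffunE; case: (y a).
  by rewrite subnn minn0.
move=> /andP[/fadjP[a ->] pp] lp; have := IHp _ pp lp.
have := hdist_le x y; have [] := hdist_flip a x y; case: ifP => _ -> _; rewrite !geq_min; move: (hdist x y) (size p) => h n; lia.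
Qed.

Lemma walk_upper x y : exists2 p : seq (folded_cube D),
  path (@fadj D) (fclass x) p && (last (fclass x) p == fclass y) &
  size p = hdist x y.
Proof.
move: {2}(hdist x y) (erefl (hdist x y)) => k; elim: k x => [|k IHk] x hk.
  exists [::]; last by rewrite hk.
  have -> : x = y.
    apply/ffunP => a; apply/eqP; apply: contraTT isT => xya.
    by have := (hdist_flip a x y).2 xya; rewrite hk.
  by rewrite /= eqxx.
have [a xya] : exists a, x a != y a.
  have /card_gt0P[a] : (0 < hdist x y)%N by rewrite hk.
  by rewrite inE; exists a.
have [E _] := hdist_flip a x y; rewrite xya hk /= in E.
have [p pp sp] := IHk _ E; exists (fclass (flip a x) :: p) => /=.
  by rewrite -andbA pp andbT; apply/fadjP; exists a.
by rewrite sp hk E.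
Qed.

(** The hypothesis keeps the length within the range that [gdist] searches. *)
Lemma gdistE x y : (minn (hdist x y) (D - hdist x y) < #|folded_cube D|)%N ->
  gdist (@fadj D) (fclass x) (fclass y) = minn (hdist x y) (D - hdist x y).
Proof.
set k := minn _ _ => kn.
pose P n := [exists p : n.-tuple (folded_cube D),
  path (@fadj D) (fclass x) p && (last (fclass x) p == fclass y)].
have Pk : P k.
  have ex p n : size p = n ->
      path (@fadj D) (fclass x) p && (last (fclass x) p == fclass y) -> P n.
    by move=> /eqP sp pp; apply/existsP; exists (Tuple sp).
  rewrite /k; case: leqP => _.
    by have [p pp sp] := walk_upper x y; apply: ex sp pp.
  (* The shorter walk ends at the other representative of the class of [y]. *)
  have [p pp sp] := walk_upper x (antipode y).
  by rewrite fclass_antipode hdist_antipode in pp sp; apply: ex sp pp.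
have min_k j : P j -> (k <= j)%N.
  by case/existsP=> p /andP[pp /eqP lp]; rewrite -[j](size_tuple p); apply: walk_lower.
rewrite /gdist -/(P) -[find _ _]/(find P _); set s := iota 0 _.
have hasP : has P s by apply/hasP; exists k => //; rewrite mem_iota.
apply/eqP; rewrite eqn_leq; apply/andP; split.
  rewrite leqNgt; apply: contraTN Pk => /(before_find 0).
  by rewrite nth_iota ?add0n // => ->.
have := nth_find 0 hasP; rewrite nth_iota; first by rewrite add0n => /min_k.
by move: hasP; rewrite has_find size_iota.
Qed.

Lemma sum_fclass (V : zmodType) (g : folded_cube D -> V) : (0 < D)%N ->
  \sum_(y : cube D) g (fclass y) = (\sum_u g u) *+ 2.
Proof.
move=> D0; rewrite (partition_big (@fclass D) predT) //= -sumrMnl.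
apply: eq_bigr => u _; have [y ->] := fclass_surj u.
rewrite (eq_bigr (fun=> g (fclass y))) => [|z /eqP-> //].
rewrite sumr_const; congr (_ *+ _).
transitivity #|[set y; antipode y]|.
  by apply: eq_card => z; rewrite !inE; apply: fclass_eq.
rewrite cards2; case: eqP => // /ffunP/(_ (Ordinal D0)).
by rewrite ffunE; case: (y _).
Qed.

Lemma card_folded_cube : (0 < D)%N -> (2 * #|folded_cube D| = 2 ^ D)%N.
Proof.
move=> D0; apply/eqP; rewrite -(eqr_nat rat) mulnC mulrnA; apply/eqP.
have := sum_fclass (fun=> 1 : rat) D0; rewrite !sumr_const => <-.
by rewrite card_ffun card_bool card_ord.
Qed.

End FoldedCubeGraph.

(** * Characters and the dual eigenvalues *)

Section SignFunctions.
Variables (K : numClosedFieldType) (D : nat).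
Implicit Types (x y z : cube D) (f : cube D -> K) (S : {set 'I_D}).

(** Written as products and sums over coordinates, these change in one factor or term under a flip.
    At Hamming distance [h], [dual_eig] is [(-1)^h (D - 2 h)], by [parityE] and [dsumE]. *)
Definition dsign x y a : K := (-1) ^+ (x a (+) y a).
Definition parity x y : K := \prod_a dsign x y a.
Definition dsum x y : K := \sum_a dsign x y a.
Definition dual_eig x y : K := parity x y * dsum x y.
Definition character S y : K := \prod_(a in S) (-1) ^+ (y a).

Lemma dsign_sqr x y a : dsign x y a * dsign x y a = 1.
Proof. by rewrite -expr2 sqrr_sign. Qed.

Lemma dsign_sym x y a : dsign x y a = dsign y x a.
Proof. by rewrite /dsign addbC. Qed.

Lemma dual_eig_sym x y : dual_eig x y = dual_eig y x.
Proof.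
by congr (_ * _); [apply: eq_bigr|apply: eq_bigr] => a _; rewrite dsign_sym.
Qed.

Lemma dsign_flip x y a b :
  dsign x (flip a y) b = dsign x y b - 2 * dsign x y b *+ (a == b).
Proof.
rewrite /dsign ffunE eq_sym; case: eqP => _; last by rewrite addbF subr0.
by rewrite addbT addbN signrN mulr1n; ring.
Qed.

Lemma dsum_flip x y a : dsum x (flip a y) = dsum x y - 2 * dsign x y a.
Proof.
rewrite /dsum (eq_bigr _ (fun b _ => dsign_flip x y a b)) sumrB; congr (_ - _).
by rewrite (bigD1 a) //= eqxx big1 ?addr0 // => b; rewrite eq_sym => /negPf->.
Qed.

Lemma parity_flip x y a : parity x (flip a y) = - parity x y.
Proof.
rewrite /parity (bigD1 a) //= [in RHS](bigD1 a) //= dsign_flip eqxx -[RHS]mulNr mulr1n.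
congr (_ * _); first by ring.
by apply: eq_bigr => b ba; rewrite dsign_flip eq_sym (negPf ba) subr0.
Qed.

Lemma parity_sqr x y : parity x y * parity x y = 1.
Proof. by rewrite -big_split big1 // => a _; apply: dsign_sqr. Qed.

Lemma dual_eig_flip x y a :
  dual_eig x (flip a y) + dual_eig x y = 2 * (parity x y * dsign x y a).
Proof. by rewrite /dual_eig parity_flip dsum_flip; ring. Qed.

Lemma parityE x y : parity x y = (-1) ^+ hdist x y.
Proof.
rewrite /hdist -sum1dep_card expr_sum big_mkcond /=; apply: eq_bigr => a _.
by rewrite /dsign; case: (x a); case: (y a).
Qed.

Lemma dsumE x y : dsum x y = D%:R - 2 * (hdist x y)%:R.
Proof.
rewrite -[D in D%:R]card_ord -sum1_card /hdist -sum1dep_card !natr_sum mulr_sumr.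
rewrite big_mkcond [X in _ - X]big_mkcond -sumrB /=; apply: eq_bigr => a _.
by rewrite /dsign; case: (x a); case: (y a) => /=; ring.
Qed.

Lemma character_flip S a y :
  character S (flip a y) = (-1) ^+ (a \in S) * character S y.
Proof.
rewrite /character; have [aS|aS] := boolP (a \in S).
  rewrite (bigD1 a) //= [in RHS](bigD1 a) //= mulrA ffunE eqxx addbT signrN mulN1r.
  congr (_ * _); apply: eq_bigr => b /andP[_ /negPf ba].
  by rewrite ffunE ba addbF.
rewrite mul1r; apply: eq_bigr => b bS; rewrite ffunE.
by case: eqP aS => [<-|]; rewrite ?bS ?addbF.
Qed.

(** The sum factors over the coordinates into [dsign y z a + 1], which is 2 where [y] and [z] agree
    and 0 where they differ. *)
Lemma sum_character y z :
  \sum_S character S y * character S z = (2 ^ D)%:R * (y == z)%:R.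
Proof.
transitivity (\prod_a (dsign y z a + 1)).
  rewrite bigA_distr; apply: eq_bigr => S _; rewrite /character -big_split /=.
  by rewrite big_mkcond; apply: eq_bigr => a _; case: ifP => // _; rewrite -signr_addb.
have [->|] := eqVneq y z.
  rewrite (eq_bigr (fun=> 2)) => [|a _].
    by rewrite prodr_const card_ord natrX mulr1.
  by rewrite /dsign addbb.
move=> yz; rewrite mulr0; apply/eqP/prodf_eq0.
have [a yza] : exists a, y a != z a.
  apply/existsP; apply: contraNT yz; rewrite negb_exists => /forallP E.
  by apply/eqP/ffunP => a; apply/eqP; have := E a; rewrite negbK.
exists a => //; rewrite /dsign.
by case: (y a) yza; case: (z a) => // _; rewrite /= addrC subrr.
Qed.

(** In [parity * dsign] the factor at [a] cancels. The characters that remain are those with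
    adjacency eigenvalue [D - 2 (D - 1) = 2 - D]. *)
Lemma dual_eig_character y z : dual_eig y z =
  \sum_a character [set~ a] y * character [set~ a] z.
Proof.
rewrite /dual_eig mulr_sumr; apply: eq_bigr => a _.
rewrite /parity (bigD1 a) //= mulrAC dsign_sqr mul1r /character -big_split /=.
by apply: eq_big => [b|b _]; [rewrite !inE | rewrite -signr_addb].
Qed.

(* Expansion in characters: [f] is orthogonal to every character whose
   eigenvalue [D - 2 * #|S|] differs from [2 - D]. *)
Lemma eigenfunction_reproducing f y :
    (forall z, \sum_a f (flip a z) = (2 - D%:R) * f z) ->
  \sum_z dual_eig y z * f z = (2 ^ D)%:R * f y.
Proof.
move=> fE; pose c S := \sum_z character S z * f z.
have c0 S : #|S|.+1 != D -> c S = 0.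
  move=> SD; apply/eqP; apply: contraTT SD => cS0; rewrite negbK.
  (* Reindexing moves the flips from [f] onto the character, so that the two eigenvalues can be
     compared. *)
  have : (\sum_a (-1) ^+ (a \in S)) * c S = (2 - D%:R) * c S.
    rewrite /c [RHS]mulr_sumr [LHS]mulr_suml.
    under [RHS]eq_bigr => z _ do rewrite mulrCA -fE mulr_sumr.
    rewrite exchange_big /=; apply: eq_bigr => a _.
    rewrite mulr_sumr [RHS](reindex_inj (inv_inj (@flipK _ a))) /=.
    by apply: eq_bigr => z _; rewrite flipK character_flip mulrA.
  move/(mulIf cS0) => E.
  have E2 : \sum_a (-1) ^+ (a \in S) = D%:R - 2 * #|S|%:R :> K.
    rewrite -[D in D%:R]card_ord -!sum1_card !natr_sum mulr_sumr.
    rewrite [X in _ - X]big_mkcond -sumrB /=; apply: eq_bigr => a _.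
    by case: (a \in S) => /=; ring.
  have /eqP : (2 * (#|S| + 1))%:R = (2 * D)%:R :> K.
    rewrite !natrM natrD; apply/eqP; rewrite -subr_eq0; apply/eqP.
    transitivity ((2 - D%:R) - (D%:R - 2 * #|S|%:R) : K); first by ring.
    by rewrite -E E2 subrr.
  by rewrite eqr_nat => /eqP h; apply/eqP; lia.
(* The sum over complements of points extends to all [S], as the other [c S] vanish; orthogonality
   of characters then evaluates it. *)
transitivity (\sum_S character S y * c S).
  transitivity (\sum_(a : 'I_D) character [set~ a] y * c [set~ a]).
    rewrite /c; under [RHS]eq_bigr => a _ do rewrite mulr_sumr.
    rewrite exchange_big /=; apply: eq_bigr => z _.
    by rewrite dual_eig_character mulr_suml; apply: eq_bigr => a _; rewrite mulrA.
  rewrite [RHS](bigID (fun S => S \in [set [set~ a] | a in 'I_D])) /=.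
  rewrite [X in _ = _ + X]big1 ?addr0 => [|S /imsetP SN].
    rewrite big_imset => //= a b _ _ /setP/(_ a).
    by rewrite !inE eqxx => /esym/negbFE/eqP.
  rewrite c0 ?mulr0 //; apply/negP => /eqP SD; apply: SN.
  have /cards1P[a aS] : #|~: S| == 1.
    by have := cardsC S; rewrite card_ord => h; apply/eqP; lia.
  by exists a => //; rewrite -aS setCK.
transitivity (\sum_z (\sum_S character S y * character S z) * f z).
  under eq_bigr => S _ do rewrite mulr_sumr.
  rewrite exchange_big /=; apply: eq_bigr => z _; rewrite mulr_suml.
  by apply: eq_bigr => S _; rewrite mulrA.
rewrite (bigD1 y) //= sum_character eqxx mulr1 big1 ?addr0 // => z zy.
by rewrite sum_character eq_sym (negPf zy) mulr0 mul0r.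
Qed.

End SignFunctions.

(** * The adjacency and dual adjacency matrices *)

Section FoldedCubeMatrices.
Variables (K : numClosedFieldType) (D : nat).
Local Notation X := (folded_cube D).
Implicit Types (x y z : cube D) (w v : 'cV[K]_#|X|).

Definition pullback w y : K := w (enum_rank (fclass y)) 0.

Lemma pullback_inj w v : pullback w =1 pullback v -> w = v.
Proof.
move=> E; apply/colP => i; have [y iy] := fclass_surj (enum_val i).
by have := E y; rewrite /pullback -iy enum_valK.
Qed.

Lemma pullbackD w v y : pullback (w + v) y = pullback w y + pullback v y.
Proof. by rewrite /pullback mxE. Qed.

Lemma pullbackZ (c : K) w y : pullback (c *: w) y = c * pullback w y.
Proof. by rewrite /pullback mxE. Qed.

Hypothesis oddD : odd D.
Let D_gt0 : (0 < D)%N. Proof. exact: odd_gt0. Qed.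

Lemma sum_pullback w : (\sum_i w i 0) *+ 2 = \sum_y pullback w y.
Proof.
rewrite (sum_fclass (fun u => w (enum_rank u) 0)) //; congr (_ *+ 2).
by rewrite (reindex enum_rank) //=; apply/onW_bij/enum_rank_bij.
Qed.

(** By [fclass_flip_inj] each neighbour comes from exactly one coordinate. *)
Lemma pullback_adjmx w y : pullback (adjmx K D *m w) y = \sum_a pullback w (flip a y).
Proof.
rewrite /pullback mxE (reindex enum_rank) /=; last exact/onW_bij/enum_rank_bij.
under eq_bigr => u _ do rewrite mxE !enum_rankK.
transitivity (\sum_(u : X) \sum_a
    (u == fclass (flip a y))%:R * w (enum_rank u) 0).
  apply: eq_bigr => u _; case: fadjP => [[a ->]|nadj].
    rewrite (bigD1 a) //= eqxx big1 ?addr0 // => b ba.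
    by rewrite (inj_eq (fclass_flip_inj oddD)) eq_sym (negPf ba) mul0r.
  rewrite mul0r big1 // => a _; case: eqP => [E|_]; last by rewrite mul0r.
  by case: nadj; exists a.
rewrite exchange_big /=; apply: eq_bigr => a _.
by rewrite (bigD1 (fclass (flip a y))) //= eqxx mul1r big1 ?addr0 // => u /negPf->;
  rewrite mul0r.
Qed.

(** As [D] is odd, replacing [h] by [D - h] reverses the sign of both factors. *)
Lemma dual_eig_antipode x y : dual_eig K x (antipode y) = dual_eig K x y.
Proof.
rewrite /dual_eig !dsumE !parityE hdist_antipode natrB ?hdist_le//.
rewrite -signr_odd oddB ?hdist_le// oddD -(signr_odd _ (hdist x y)).
by case: (odd _); rewrite ?expr0 ?expr1; ring.
Qed.

Definition dual_col x : 'cV[K]_#|X| :=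
  \col_i dual_eig K x (odflt x [pick y | fclass y == enum_val i]).

Lemma pullback_dual_col x y : pullback (dual_col x) y = dual_eig K x y.
Proof.
rewrite /pullback mxE enum_rankK; case: pickP => [z|/(_ y)]; last by rewrite eqxx.
by rewrite /= fclass_eq => /orP[]/eqP->; rewrite ?dual_eig_antipode.
Qed.

Lemma dual_eig_conj x y : (dual_eig K x y)^* = dual_eig K x y.
Proof.
rewrite /dual_eig rmorphM rmorph_prod rmorph_sum /=.
by congr (_ * _); apply: eq_bigr => a _; rewrite /dsign rmorph_sign.
Qed.

Lemma dual_col_eigen x : adjmx K D *m dual_col x = qeigval K D 1 *: dual_col x.
Proof.
apply: pullback_inj => y; rewrite pullback_adjmx pullbackZ pullback_dual_col.
under eq_bigr => a _ do rewrite pullback_dual_col /dual_eig parity_flip dsum_flip mulNr.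
rewrite sumrN -mulr_sumr sumrB -mulr_sumr sumr_const card_ord -/(dsum K x y).
by rewrite /dual_eig /qeigval mulr1 expr1 -mulr_natr; ring.
Qed.

Lemma dual_col_reproducing w y : adjmx K D *m w = qeigval K D 1 *: w ->
  \sum_i dual_col y i 0 * w i 0 = #|X|%:R * pullback w y.
Proof.
move=> Aw; have two0 : (2 : K) != 0 by rewrite pnatr_eq0.
apply: (mulIf two0); rewrite mulr_natr.
pose v : 'cV[K]_#|X| := \col_i (dual_col y i 0 * w i 0).
have -> : \sum_i dual_col y i 0 * w i 0 = \sum_i v i 0.
  by apply: eq_bigr => i _; rewrite [RHS]mxE.
rewrite sum_pullback (eq_bigr (fun z => dual_eig K y z * pullback w z)) => [|z _]; last first.
  by rewrite -pullback_dual_col [LHS]mxE.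
rewrite eigenfunction_reproducing -?(card_folded_cube D_gt0) => [|z].
  by rewrite natrM; ring.
by rewrite -pullback_adjmx Aw pullbackZ /qeigval expr1; ring.
Qed.

(** The unit vector at [y] projects to [dual_col y] divided by [#|X|]: this lies in the eigenspace,
    and the remainder is orthogonal to it by [dual_col_reproducing]. *)
Lemma eigenproj_qeigval1 x y :
  #|X|%:R * eigenproj (adjmx K D) (qeigval K D 1) (enum_rank (fclass x))
    (enum_rank (fclass y)) = dual_eig K x y.
Proof.
set i := enum_rank (fclass x); set j := enum_rank (fclass y).
have n0 : #|X|%:R != 0 :> K.
  by rewrite pnatr_eq0 -lt0n; apply/card_gt0P; exists (fclass x).
rewrite /eigenproj mxE; set V := eigenspace _ _; set P := spectral.proj_ortho V.
pose r := (dual_col y)^T.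
have rV : (r <= V)%MS.
  by apply/eigenspaceP; rewrite /r -trmx_mul dual_col_eigen linearZ.
have dP : ((delta_mx 0 j : 'rV_#|X|) - #|X|%:R^-1 *: r) *m P = 0.
  apply: spectral.proj_ortho_0; rewrite orthomx_sym; apply/rV_subP => v /eigenspaceP vV.
  have {}vV : adjmx K D *m v^T = qeigval K D 1 *: v^T.
    by apply: trmx_inj; rewrite trmx_mul trmxK vV linearZ /= trmxK.
  rewrite spectral.orthomx1E; apply/eqP/matrixP => k l; rewrite !ord1 !mxE.
  under eq_bigr => a _ do rewrite !mxE rmorphB rmorphM fmorphV !rmorph_nat /= dual_eig_conj mulrBr.
  rewrite sumrB (bigD1 j) //= eqxx mulr1 big1 ?addr0 => [|a /negPf->]; last by rewrite mulr0.
  have := dual_col_reproducing y vV; rewrite /pullback mxE => E.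
  rewrite (eq_bigr (fun a => #|X|%:R^-1 * (dual_col y a 0 * v^T a 0))) => [|a _].
    by rewrite -mulr_sumr E mulKf // subrr.
  by rewrite !mxE mulrC -mulrA.
have -> : P j i = ((delta_mx 0 j : 'rV_#|X|) *m P) 0 i.
  by rewrite -rowE [RHS]mxE.
rewrite -[delta_mx 0 j](subrK (#|X|%:R^-1 *: r)) mulmxDl mxE.
rewrite dP mxE add0r -scalemxAl (spectral.proj_ortho_id rV).
by rewrite mxE mulrA divff // mul1r mxE -/(pullback _ _) pullback_dual_col dual_eig_sym.
Qed.

Lemma pullback_diag (d : 'rV[K]_#|X|) w y :
  pullback (diag_mx d *m w) y = d 0 (enum_rank (fclass y)) * pullback w y.
Proof. by rewrite /pullback mul_diag_mx mxE. Qed.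

Lemma pullback_dual_adjmx x w y :
  pullback (dual_adjmx K x *m w) y = dual_eig K x y * pullback w y.
Proof. by rewrite pullback_diag mxE eigenproj_qeigval1. Qed.

(** The weight of an edge is the mean of [dual_eig] at its two ends, which [dual_eig_flip]
    evaluates. *)
Lemma pullback_third_adjmx x w y : pullback (third_adjmx K x *m w) y =
  parity K x y * \sum_a dsign K x y a * pullback w (flip a y).
Proof.
have two0 : (2 : K) != 0 by rewrite pnatr_eq0.
rewrite -scalemxAl pullbackZ mulmxDl pullbackD -!mulmxA pullback_adjmx pullback_dual_adjmx.
rewrite pullback_adjmx [X in _ + X]mulr_sumr -big_split [RHS]mulr_sumr mulr_sumr /=.
apply: eq_bigr => a _; rewrite pullback_dual_adjmx -mulrDl dual_eig_flip.
by rewrite !mulrA mulVf // mul1r.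
Qed.

Lemma mul_adj_dual x w : adjmx K D *m (dual_adjmx K x *m w) +
  dual_adjmx K x *m (adjmx K D *m w) = 2 *: (third_adjmx K x *m w).
Proof.
have two0 : (2 : K) != 0 by rewrite pnatr_eq0.
by rewrite -scalemxAl scalerA mulfV // scale1r mulmxDl !mulmxA.
Qed.

(** Each edge weight [p * s] of [C] is multiplied by the sum of [dual_eig] over the two ends, which
    is [2 * (p * s)]; and [p], [s] are signs. *)
Lemma mul_dual_third x w : dual_adjmx K x *m (third_adjmx K x *m w) +
  third_adjmx K x *m (dual_adjmx K x *m w) = 2 *: (adjmx K D *m w).
Proof.
apply: pullback_inj => y; rewrite pullbackD pullback_dual_adjmx !pullback_third_adjmx pullbackZ pullback_adjmx.
rewrite !mulr_sumr -big_split /=; apply: eq_bigr => a _; rewrite pullback_dual_adjmx.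
set p := parity K x y; set s := dsign K x y a; set f := pullback w _.
transitivity ((dual_eig K x (flip a y) + dual_eig K x y) * (p * s) * f); first by ring.
rewrite dual_eig_flip -/p -/s.
have -> : 2 * (p * s) * (p * s) = 2 * (p * p) * (s * s) by ring.
by rewrite parity_sqr dsign_sqr !mulr1.
Qed.

(** Both products sum over two successive flips. The coefficients split into [G], antisymmetric in
    the two coordinates because flips commute, and a diagonal part where the flips cancel, which
    adds up to [2 * dual_eig]. *)
Lemma mul_third_adj x w : third_adjmx K x *m (adjmx K D *m w) +
  adjmx K D *m (third_adjmx K x *m w) = 2 *: (dual_adjmx K x *m w).
Proof.
apply: pullback_inj => y; rewrite pullbackD pullback_third_adjmx pullback_adjmx pullbackZ pullback_dual_adjmx.
pose G a b := (dsign K x y a - dsign K x y b) * pullback w (flip b (flip a y)).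
transitivity (parity K x y * (\sum_a \sum_b G a b +
    2 * \sum_a dsign K x y a * pullback w y)).
  rewrite [2 * _]mulr_sumr -big_split mulr_sumr mulr_sumr -big_split /=.
  apply: eq_bigr => a _; rewrite pullback_adjmx pullback_third_adjmx parity_flip mulNr -mulrBr.
  congr (_ * _); rewrite mulr_sumr -sumrB.
  have -> : 2 * (dsign K x y a * pullback w y) =
      \sum_b (2 * dsign K x y b *+ (a == b)) * pullback w (flip b (flip a y)).
    rewrite (bigD1 a) //= eqxx flipK big1 ?addr0 => [|b]; first by rewrite mulr1n mulrA.
    by rewrite eq_sym => /negPf->; rewrite mul0r.
  rewrite -big_split /=; apply: eq_bigr => b _.
  by rewrite dsign_flip /G -mulrBl opprB addrA addrAC mulrDl.
have -> : \sum_a \sum_b G a b = 0.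
  have two0 : (2 : K) != 0 by rewrite pnatr_eq0.
  apply: (mulfI two0); rewrite mulr0 mulr2n mulrDl mul1r {2}exchange_big /=.
  rewrite -big_split big1 // => a _; rewrite -big_split big1 // => b _.
  by rewrite /G flipC /= -mulrDl addrA subrK subrr mul0r.
by rewrite add0r -mulr_suml mulrCA /dual_eig -!mulrA.
Qed.

(** * Dual eigenvalues as functions of the distance *)

Section Distances.
Variable m : nat.
Hypothesis Dm : D = (2 * m + 1)%N.

(** The range condition holds since the minimum is at most [m] and there are [2 ^ (2 m)]
    vertices. *)
Lemma gdist_fclass x y :
  gdist (@fadj D) (fclass x) (fclass y) = minn (hdist x y) (D - hdist x y).
Proof.
apply: gdistE; have := card_folded_cube D_gt0.
have : (m.*2 < 2 ^ m.*2)%N by exact: ltn_expl.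
have -> : (2 ^ D = 2 * 2 ^ m.*2)%N by rewrite -expnS Dm -mul2n addn1.
have := hdist_le x y; move: (hdist x y) (2 ^ m.*2)%N #|X| => h p n; lia.
Qed.

Lemma gdist_le x u : (gdist (@fadj D) (fclass x) u <= m)%N.
Proof.
have [y ->] := fclass_surj u; rewrite gdist_fclass.
have := hdist_le x y; lia.
Qed.

Lemma dual_eigE x y :
  dual_eig K x y = qeigval K D (gdist (@fadj D) (fclass x) (fclass y)).
Proof.
rewrite gdist_fclass /minn; case: ifP => _.
  by rewrite /dual_eig parityE dsumE.
by rewrite -hdist_antipode -dual_eig_antipode /dual_eig parityE dsumE.
Qed.

Lemma dual_adjmx_diag x : dual_adjmx K x =
  diag_mx (\row_j qeigval K D (gdist (@fadj D) (fclass x) (enum_val j))).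
Proof.
congr diag_mx; apply/rowP => j; rewrite mxE [RHS]mxE.
have [y jy] := fclass_surj (enum_val j).
by rewrite -[in LHS](enum_valK j) jy eigenproj_qeigval1 dual_eigE.
Qed.

Lemma qeigval_odd i : (i <= m)%N ->
  qeigval K D i = (-1) ^+ i * (2 * (m - i) + 1)%:R.
Proof.
move=> im; rewrite /qeigval; congr (_ * _).
by rewrite -natrM -natrB ?Dm; [congr _%:R|]; lia.
Qed.

Lemma qeigval_inj i j : (i <= m)%N -> (j <= m)%N ->
  qeigval K D i = qeigval K D j -> i = j.
Proof.
move=> im jm; rewrite !qeigval_odd // => /(sign_mul_nat_inj (sqrr_sign _ i) (sqrr_sign _ j)).
lia.
Qed.

Lemma dual_adjmx_sum x :
  dual_adjmx K x = \sum_(i < m.+1) qeigval K D i *: dual_idem K x i.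
Proof.
rewrite dual_adjmx_diag; apply/matrixP => j k; rewrite summxE !mxE.
have gm := gdist_le x (enum_val j).
rewrite (bigD1 (Ordinal (gm : (_ < m.+1)%N))) //= big1 ?addr0 => [|i ne].
  rewrite !mxE eqxx; case: (j == k); rewrite ?mulr0n ?mulr1n ?mulr0 ?mulr1 //.
rewrite !mxE; case: eqP => [E|_]; last by rewrite mul0rn mulr0.
by case/eqP: ne; apply: val_inj.
Qed.

End Distances.

Lemma diag_horner_stable n (d : 'rV[K]_n) (U : {vspace 'cV[K]_n}) (p : {poly K}) :
  mx_stable (diag_mx d) U -> mx_stable (diag_mx (\row_j p.[d 0 j])) U.
Proof.
move=> dU; elim/poly_ind: p => [|p c IHp] w wU.
  rewrite (_ : _ *m w = 0) ?mem0v //; apply/matrixP => i j.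
  by rewrite mul_diag_mx !mxE horner0 mul0r.
have -> : diag_mx (\row_j (p * 'X + c%:P).[d 0 j]) *m w =
    diag_mx (\row_j p.[d 0 j]) *m (diag_mx d *m w) + c *: w.
  by apply/matrixP => i j; rewrite !mul_diag_mx !mxE !hornerE /= mulrDl -?mulrA.
by rewrite memvD ?memvZ // IHp // dU.
Qed.

End FoldedCubeMatrices.

(** * Terwilliger modules as modules for the spin relations *)

Section TerwilligerModule.
Variables (K : numClosedFieldType) (m D : nat) (x : cube D).
Hypothesis Dm : D = (2 * m + 1)%N.
Local Notation A := (adjmx K D).
Local Notation B := (dual_adjmx K x).
Local Notation C := (third_adjmx K x).
Implicit Types U W : {vspace 'cV[K]_#|folded_cube D|}.

Let oddD : odd D.
Proof. by rewrite Dm addn1 /= mul2n odd_double. Qed.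

Lemma terwilliger_stable U :
  is_submodule (@terwilliger K D x m) U <-> mx_stable A U /\ mx_stable B U.
Proof.
split=> [sub|[AU BU]].
  split; first by apply: sub; apply: gen_alg_gen; left.
  move=> w wU; rewrite (dual_adjmx_sum K oddD Dm) mulmx_suml memv_suml // => i _.
  rewrite -scalemxAl memvZ // sub //; apply: gen_alg_gen; right.
  by exists (val i) => //; apply: leq_ord.
move=> M; elim=> {M} [M [->//|[i im ->]]||M N _ MU _ NU|a M _ MU|M N _ MU _ NU] w wU.
(* Lagrange interpolation: [c^-1 *: p] is 1 at the dual eigenvalue of index [i] and 0 at the others,
   so it turns [B] into the dual idempotent. *)
- pose p := \prod_(k < m.+1 | k != i :> nat) ('X - (qeigval K D k)%:P).
  pose c := p.[qeigval K D i].
  have c0 : c != 0.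
    rewrite /c horner_prod; apply/prodf_neq0 => k ki; rewrite !hornerE subr_eq0.
    apply/eqP => /(qeigval_inj oddD Dm im) E; move/eqP: ki; apply; apply/esym/E.
    by rewrite -ltnS.
  rewrite (dual_adjmx_diag K oddD Dm) in BU.
  have := diag_horner_stable (c^-1 *: p) BU wU.
  congr (_ *m _ \in U); congr diag_mx; apply/rowP => j; rewrite !mxE hornerZ.
  case: eqP => [->|/eqP ne]; first by rewrite mulVf.
  have gm := gdist_le oddD Dm x (enum_val j).
  rewrite /p horner_prod (bigD1 (Ordinal (gm : (_ < m.+1)%N))) //=.
  by rewrite hornerXsubC subrr mul0r mulr0.
- by rewrite mul1mx.
- by rewrite mulmxDl memvD ?MU ?NU.
- by rewrite -scalemxAl memvZ ?MU.
- by rewrite -mulmxA MU ?NU.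
Qed.

Lemma third_stable U : mx_stable A U -> mx_stable B U -> mx_stable C U.
Proof.
move=> AU BU w wU; rewrite -scalemxAl mulmxDl -!mulmxA memvZ // memvD //.
  by rewrite AU ?BU.
by rewrite BU ?AU.
Qed.

Lemma action_onE W (M : 'M[K]_#|folded_cube D|) (w : subvs_of W) :
  mx_stable M W -> vsval (action_on W M w) = M *m vsval w.
Proof. by move=> MW; rewrite lfunE /= vsprojK // MW // subvsP. Qed.

Section Action.
Variable W : {vspace 'cV[K]_#|folded_cube D|}.
Hypothesis irrW : irreducible_module (@terwilliger K D x m) W.

Lemma module_stable : [/\ mx_stable A W, mx_stable B W & mx_stable C W].
Proof.
have [_ /terwilliger_stable[AW BW] _] := irrW.
by split=> //; apply: third_stable.
Qed.

Let fA := action_on W A.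
Let fB := action_on W B.
Let fC := action_on W C.

Lemma action_anticomm_spin : anticomm_spin fA fB fC.
Proof.
have [AW BW CW] := module_stable.
by split=> w; apply: subvs_inj; rewrite linearD linearZ /= !action_onE //;
  [exact: mul_adj_dual | exact: mul_dual_third | exact: mul_third_adj].
Qed.

Lemma action_jointly_irreducible : jointly_irreducible fA fB fC.
Proof.
have [W0 _ minW] := irrW; have [AW BW _] := module_stable.
split.
  apply: contraNneq W0 => U0; rewrite -vpick0.
  have : vsproj W (vpick W) \in fullv by exact: memvf.
  rewrite U0 memv0 => /eqP/(congr1 vsval).
  by rewrite vsprojK ?memv_pick // linear0 => ->.
(* [U] is [V] seen inside the standard module, where the irreducibility of [W] applies. *)
move=> V AV BV _; pose U := (linfun vsval @: V)%VS.
have memU w : reflect (exists2 v, v \in V & w = vsval v) (w \in U).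
  by apply: (iffP memv_imgP) => -[v vV ->]; exists v; rewrite ?lfunE.
have stab M : mx_stable M W -> (action_on W M @: V <= V)%VS -> mx_stable M U.
  move=> MW MV _ /memU[v vV ->]; apply/memU; exists (action_on W M v).
    by apply: (subvP MV); apply: memv_img.
  by rewrite action_onE.
have [|||UW] := minW U.
- by apply/subvP => _ /memU[v _ ->]; apply: subvsP.
- by apply/terwilliger_stable; split; apply: stab.
- move=> U0; left; apply/eqP; rewrite -subv0; apply/subvP => v vV.
  have : vsval v \in U by apply/memU; exists v.
  rewrite U0 !memv0 => /eqP v0; apply/eqP/subvs_inj.
  by rewrite v0 linear0.
right; apply/eqP; rewrite eqEsubv subvf; apply/subvP => v _.
have : vsval v \in U by rewrite UW subvsP.
by case/memU=> v' v'V /subvs_inj ->.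
Qed.

(** [B] acts by multiplication, so at a vertex where the eigenvector is nonzero the eigenvalue is a
    value of [dual_eig], a signed odd number. *)
Lemma action_dual_eigenvector :
  exists d j, exists2 w, d ^+ 2 = 1 & w != 0 /\ fB w = (d * (2 * j + 1)%:R) *: w.
Proof.
have [_ BW _] := module_stable.
have [th [w w0 Bw]] := eigenvector_exists fB (proj1 action_jointly_irreducible).
have Bv : B *m vsval w = th *: vsval w by rewrite -action_onE // Bw linearZ.
have [y wy] : exists y, pullback (vsval w) y != 0.
  case: (boolP [exists y, pullback (vsval w) y != 0]) => [/existsP//|].
  rewrite negb_exists => /forallP z; case/eqP: w0; apply: subvs_inj.
  rewrite linear0; apply: pullback_inj => y; have := z y; rewrite negbK => /eqP->.
  by rewrite /pullback mxE.
exists ((-1) ^+ gdist (@fadj D) (fclass x) (fclass y)).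
exists (m - gdist (@fadj D) (fclass x) (fclass y))%N, w; first exact: sqrr_sign.
split=> //; rewrite -(qeigval_odd K oddD Dm) ?(gdist_le oddD Dm) // -(dual_eigE K oddD Dm).
rewrite Bw; congr (_ *: _); apply: (mulIf wy).
by rewrite -(pullback_dual_adjmx oddD) Bv pullbackZ.
Qed.

Lemma irreducible_module_leonard :
  [/\ leonard_triple fA fB fC, totally_almost_bipartite fA fB fC &
      bannai_ito_type fA fB fC].
Proof.
have [d [j [w d2 [w0 Bw]]]] := action_dual_eigenvector.
exact: anticomm_spin_leonard action_anticomm_spin action_jointly_irreducible d2 w0 Bw.
Qed.

End Action.
End TerwilligerModule.

From mathcomp Require Import reals complex.
Local Open Scope complex_scope.

Theorem theorem13p10 (R : realType) (m D : nat) (hD : D = (2 * m + 1)%N)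
    (x : cube D) (W : {vspace 'cV[R[i]]_#|folded_cube D|})
    (hW : irreducible_module (@terwilliger R[i] D x m) W) :
  let A := adjmx R[i] D in
  let B := dual_adjmx R[i] x in
  let C := third_adjmx R[i] x in
  [/\ mx_stable A W, mx_stable B W & mx_stable C W] /\
  [/\ leonard_triple (action_on W A) (action_on W B) (action_on W C),
      totally_almost_bipartite (action_on W A) (action_on W B) (action_on W C) &
      bannai_ito_type (action_on W A) (action_on W B) (action_on W C)].
Proof.
split; first exact: (module_stable hD hW).
exact: (irreducible_module_leonard hD hW).
Qed.
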